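(* Let $N\ge 1$, let $D\subset\mathbb{R}^N$ be a linear subspace of dimension $p$ with $p<N$, let $P_D$ be the orthogonal projection of $\mathbb{R}^N$ onto $D$, and let $K\in\mathbb{R}^{N\times N}$ satisfy $K=P_DKP_D$ and be such that $I-K$ is nonsingular. Then there exist constants $\delta>0$ and $C>0$ (depending only on $K$, $D$) such that the following holds for every $E\in\mathbb{R}^{N\times N}$ with $\|E\|\le\delta$. Put $A=I-K+E$. For every right-hand side $b\in\mathbb{R}^N$ and every initial iterate $x_0\in\mathbb{R}^N$, the GMRES residuals $r_k$ for the linear system $Ax=b$ started at $x_0$ satisfy, for all integers $m\ge 1$, $$\|r_{m(p+1)}\|\le C^m\,\|E\|^m\,\|r_0\|.$$
   Context: $\|\cdot\|$ is the Euclidean norm on $\mathbb{R}^N$ and the induced operator norm on matrices. GMRES for $Ax=b$ with initial iterate $x_0$: let $r_0=b-Ax_0$ and, for $k\ge1$, let $\mathcal{K}_k=\mathrm{span}\{r_0,Ar_0,\dots,A^{k-1}r_0\}$ be the $k$th Krylov subspace. The $k$th GMRES iterate $x_k$ minimizes $\|b-Ax\|$ over $x\in x_0+\mathcal{K}_k$, and $r_k=b-Ax_k$ is the $k$th residual. Equivalently, $\|r_k\|=\min_{q\in\mathcal{P}_k}\|q(A)r_0\|$, where $\mathcal{P}_k$ is the set of real polynomials $q$ of degree at most $k$ with $q(0)=1$. In the paper's setting $p$ is much smaller than $N$ and $E$ is ''a matrix with small norm''. *)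

(* Defs.v *)
From HB Require Import structures.
From mathcomp Require Import all_boot all_order all_algebra.
From mathcomp Require Import all_classical all_reals.

Set Implicit Arguments.
Unset Strict Implicit.
Unset Printing Implicit Defensive.

Import Order.TTheory GRing.Theory Num.Theory.
Local Open Scope classical_set_scope.
Local Open Scope ring_scope.

Definition dotv (R : realType) (n : nat) (u v : 'cV[R]_n) : R :=
  \sum_(i < n) u i 0 * v i 0.

(* MathComp-Analysis norms matrices by the max of the entries, so the
   Euclidean norm and the operator norm it induces are defined here. *)
Definition enorm (R : realType) (n : nat) (u : 'cV[R]_n) : R :=
  Num.sqrt (dotv u u).

Definition opnorm (R : realType) (n : nat) (A : 'M[R]_n) : R :=
  sup [set enorm (A *m u) | u in [set u : 'cV[R]_n | enorm u <= 1]].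

(* This determines P uniquely. *)
Definition is_orth_proj (R : realType) (n : nat)
    (D : {vspace 'cV[R]_n}) (P : 'M[R]_n) : Prop :=
  forall u : 'cV[R]_n,
    P *m u \in D /\ forall v, v \in D -> dotv (u - P *m u) v = 0.

Definition krylov (R : realType) (n : nat) (A : 'M[R]_n) (r : 'cV[R]_n)
    (k : nat) : {vspace 'cV[R]_n} :=
  <<[seq A ^+ i *m r | i <- iota 0 k]>>%VS.

Definition residual (R : realType) (n : nat) (A : 'M[R]_n)
    (b x : 'cV[R]_n) : 'cV[R]_n := b - A *m x.

Definition is_gmres_iterate (R : realType) (n : nat) (A : 'M[R]_n)
    (b x0 : 'cV[R]_n) (k : nat) (xk : 'cV[R]_n) : Prop :=
  xk - x0 \in krylov A (residual A b x0) k /\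
  forall y, y - x0 \in krylov A (residual A b x0) k ->
    enorm (residual A b xk) <= enorm (residual A b y).

(* A relation and not a function: when A is singular the minimizer need not
   be unique, although the residual is. *)
Definition is_gmres (R : realType) (n : nat) (A : 'M[R]_n)
    (b x0 : 'cV[R]_n) (x : nat -> 'cV[R]_n) : Prop :=
  x 0%N = x0 /\ forall k, (1 <= k)%N -> is_gmres_iterate A b x0 k (x k).

(* Main.v *)
Require Import Defs.
From HB Require Import structures.
From mathcomp Require Import all_boot all_order all_algebra.
From mathcomp Require Import all_classical all_reals.
From mathcomp Require Import ring.

(* The matrix K factors through the p-dimensional space D, say K = V W with V of
   size N x p, and A0 = I - K satisfies A0 V = V B with B = I - W V of size
   p x p.  By Cayley-Hamilton the characteristic polynomial chi of B satisfies
   chi(A0) V = 0, so (1 - t) chi(t), of degree p + 1, annihilates A0; its value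
   at 0 is nonzero because B is nonsingular together with A0.  Normalizing it
   gives q with q(0) = 1 and q(A0) = 0, so ||q(A0 + E)|| <= C ||E|| for
   ||E|| <= 1, and q^m is an admissible competitor in the GMRES minimization at
   step m(p + 1). *)

Set Implicit Arguments.
Unset Strict Implicit.
Unset Printing Implicit Defensive.

Import Order.TTheory GRing.Theory Num.Theory.
Local Open Scope ring_scope.

(** * Polynomials annihilating the identity minus a low-rank matrix *)

Section Annihilator.
Variables (F : fieldType) (n : nat).
Implicit Types (A : 'M[F]_n.+1) (q : {poly F}).

Lemma horner_mx_intertwine p A (V : 'M_(n.+1, p.+1)) (B : 'M_p.+1) q :
  A *m V = V *m B -> horner_mx A q *m V = V *m horner_mx B q.
Proof.
move=> AV; elim/poly_ind: q => [|q c IHq]; first by rewrite !rmorph0 mul0mx mulmx0.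
rewrite !rmorphD !rmorphM /= !horner_mx_X !horner_mx_C mulmxDl mulmxDr.
by rewrite -!mulmxE -mulmxA AV mulmxA IHq -mulmxA mul_scalar_mx mul_mx_scalar.
Qed.

Lemma horner_mx_char_poly_intertwine p A (V : 'M_(n.+1, p)) (B : 'M_p) :
  A *m V = V *m B -> horner_mx A (char_poly B) *m V = 0.
Proof.
(* Cayley-Hamilton and [horner_mx] need a matrix of positive size; for [p = 0] the matrix [V] has no
   columns. *)
case: p V B => [|p] V B AV; first by rewrite [V]thinmx0 mulmx0.
by rewrite (horner_mx_intertwine _ AV) Cayley_Hamilton mulmx0.
Qed.

Lemma low_rank_perturbation_annihilator p (V : 'M[F]_(n.+1, p))
    (W : 'M_(p, n.+1)) :
  1%:M - V *m W \in unitmx ->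
  exists q, [/\ (size q <= p.+2)%N, q.[0] = 1
               & horner_mx (1%:M - V *m W) q = 0].
Proof.
set A := 1%:M - V *m W => Aunit; pose B : 'M_p := 1%:M - W *m V.
have AV : A *m V = V *m B.
  by rewrite mulmxBl mulmxBr mul1mx mulmx1 mulmxA.
(* If [v B = 0] for a row vector [v], then [v = v W V], hence [v W A = v W - v W V W = 0]. As [A] is
   invertible, [v W = 0], and so [v = 0]. *)
have chi0 : (char_poly B).[0] != 0.
  rewrite -[_ != 0]/(~~ root (char_poly B) 0) -eigenvalue_root_char.
  apply/eigenvalueP => -[v]; rewrite scale0r mulmxBr mulmx1 => /eqP.
  rewrite subr_eq0 => /eqP vWV /negP[]; rewrite vWV mulmxA.
  suff -> : v *m W = 0 by rewrite mul0mx.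
  rewrite -[LHS](mulmxK Aunit) mulmxBr mulmx1 !mulmxA -[v *m W *m V]mulmxA -vWV.
  by rewrite subrr mul0mx.
pose chi1 := char_poly B * (1 - 'X).
exists ((char_poly B).[0]^-1 *: chi1); split.
- apply: leq_trans (size_scale_leq _ _) _.
  apply: leq_trans (size_polyMleq _ _) _.
  by rewrite size_char_poly -[1 - 'X]opprB size_polyN -polyC1 size_XsubC addn2.
- rewrite hornerZ hornerM; have -> : (1 - 'X : {poly F}).[0] = 1 by rewrite !hornerE subr0.
  by rewrite mulr1 mulVf.
(* The factor [1 - 'X] evaluates to [1 - A = V W], which supplies the [V] that [char_poly B] at [A]
   kills. *)
rewrite horner_mxZ rmorphM /= rmorphB rmorph1 /= horner_mx_X.
rewrite -[1 - A]/(1%:M - (1%:M - V *m W)) subKr -mulmxE mulmxA.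
by rewrite (horner_mx_char_poly_intertwine AV) mul0mx scaler0.
Qed.

End Annihilator.

(** * Euclidean norm and operator bounds *)

Section Norms.
Variable (R : realType).

Section Euclidean.
Variable (n : nat).
Implicit Types (u v w : 'cV[R]_n) (A B : 'M[R]_n).

Lemma dotvC u v : dotv u v = dotv v u.
Proof. by apply: eq_bigr => i _; rewrite mulrC. Qed.

Lemma dotvDl u v w : dotv (u + v) w = dotv u w + dotv v w.
Proof. by rewrite -big_split; apply: eq_bigr => i _; rewrite mxE mulrDl. Qed.

Lemma dotvZl a u v : dotv (a *: u) v = a * dotv u v.
Proof. by rewrite mulr_sumr; apply: eq_bigr => i _; rewrite mxE mulrA. Qed.

Lemma dotv_ge0 u : 0 <= dotv u u.
Proof. by apply: sumr_ge0 => i _; rewrite -expr2 sqr_ge0. Qed.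

Lemma dotv_eq0 u : dotv u u = 0 -> u = 0.
Proof.
move=> u0; apply/matrixP => i j; rewrite ord1 mxE.
have sq_ge0 k : true -> 0 <= u k 0 * u k 0 by rewrite -expr2 sqr_ge0.
have /eqP := psumr_eq0P sq_ge0 u0 (i := i) isT.
by rewrite mulf_eq0 orbb => /eqP.
Qed.

Lemma enorm_ge0 u : 0 <= enorm u.
Proof. exact: sqrtr_ge0. Qed.

Lemma sqr_enorm u : enorm u ^+ 2 = dotv u u.
Proof. by rewrite sqr_sqrtr ?dotv_ge0. Qed.

Lemma enorm0 : enorm (0 : 'cV[R]_n) = 0.
Proof.
by rewrite /enorm /dotv big1 ?sqrtr0 // => i _; rewrite mxE mulr0.
Qed.

Lemma enorm_eq0 u : enorm u = 0 -> u = 0.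
Proof. by move=> u0; apply: dotv_eq0; rewrite -sqr_enorm u0 expr0n. Qed.

Lemma enormZ a u : enorm (a *: u) = `|a| * enorm u.
Proof.
by rewrite /enorm dotvZl dotvC dotvZl mulrA -expr2 sqrtrM ?sqr_ge0 ?sqrtr_sqr.
Qed.

Lemma dotv_le_enorm u v : dotv u v <= enorm u * enorm v.
Proof.
have [v0|v_neq0] := eqVneq (dotv v v) 0.
  by rewrite (dotv_eq0 v0) enorm0 mulr0 dotvC -(scale0r u) dotvZl mul0r.
have v_gt0 : 0 < dotv v v by rewrite lt0r v_neq0 dotv_ge0.
apply: le_trans (ler_norm _) _.
rewrite -(@ler_pXn2r _ 2) ?nnegrE ?mulr_ge0 ?enorm_ge0 // exprMn !sqr_enorm.
rewrite real_normK ?num_real //.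
(* Cauchy-Schwarz: up to the factor [dotv v v], this vector is the component of [u] orthogonal to
   [v]. *)
have := dotv_ge0 (dotv v v *: u + (- dotv u v) *: v).
rewrite dotvDl !dotvZl ![dotv _ (_ + _)]dotvC !dotvDl !dotvZl (dotvC v u).
set a := dotv u u; set b := dotv u v; set c := dotv v v.
have -> : c * (c * a + - b * b) + - b * (c * b + - b * c) = c * (a * c - b ^+ 2).
  by ring.
by rewrite pmulr_rge0 // subr_ge0.
Qed.

Lemma enormD u v : enorm (u + v) <= enorm u + enorm v.
Proof.
rewrite -(@ler_pXn2r _ 2) ?nnegrE ?addr_ge0 ?enorm_ge0 // sqrrD !sqr_enorm.
rewrite dotvDl ![dotv _ (_ + _)]dotvC !dotvDl (dotvC v u) addrA lerD2r.
by rewrite -addrA lerD2l -mulr2n lerMn2r dotv_le_enorm.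
Qed.

Lemma enorm_sum (I : Type) (r : seq I) (f : I -> 'cV[R]_n) :
  enorm (\sum_(i <- r) f i) <= \sum_(i <- r) enorm (f i).
Proof.
elim/big_ind2: _ => [|u a v b ua vb|//]; first by rewrite enorm0.
exact: le_trans (enormD _ _) (lerD ua vb).
Qed.

Lemma coord_le_enorm u i : `|u i 0| <= enorm u.
Proof.
rewrite -sqrtr_sqr ler_wsqrtr // /dotv (bigD1 i) //= -expr2 lerDl.
by apply: sumr_ge0 => j _; rewrite -expr2 sqr_ge0.
Qed.

(** An operator-norm bound stated without the supremum, so that sums and products are handled vector
    by vector; [op_le_opnorm] links it to [opnorm]. *)
Definition op_le A (a : R) := forall u, enorm (A *m u) <= a * enorm u.

Lemma op_leD A B a b : op_le A a -> op_le B b -> op_le (A + B) (a + b).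
Proof.
move=> Aa Bb u; rewrite mulmxDl mulrDl.
exact: le_trans (enormD _ _) (lerD (Aa u) (Bb u)).
Qed.

Lemma op_leM A B a b :
  0 <= a -> op_le A a -> op_le B b -> op_le (A *m B) (a * b).
Proof.
move=> a0 Aa Bb u; rewrite -mulmxA -mulrA.
exact: le_trans (Aa _) (ler_wpM2l a0 (Bb u)).
Qed.

Lemma op_le_trans A a b : a <= b -> op_le A a -> op_le A b.
Proof.
by move=> ab Aa u; apply: le_trans (Aa u) _; rewrite ler_wpM2r ?enorm_ge0.
Qed.

(** The crude bound by column norms shows that the set defining [opnorm] is bounded above, without
    which [sup] would be a default value. *)
Lemma op_le_exists A : exists2 a, 0 <= a & op_le A a.
Proof.
exists (\sum_j enorm (col j A)); first by apply: sumr_ge0 => j _; exact: enorm_ge0.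
move=> u; have -> : A *m u = \sum_j u j 0 *: col j A.
  apply/matrixP => i k; rewrite ord1 summxE mxE.
  by apply: eq_bigr => j _; rewrite !mxE mulrC.
apply: le_trans (enorm_sum _ _) _; rewrite mulr_suml; apply: ler_sum => j _.
by rewrite enormZ mulrC ler_wpM2l ?enorm_ge0 ?coord_le_enorm.
Qed.

Lemma enorm_le_opnorm A u : enorm u <= 1 -> enorm (A *m u) <= opnorm A.
Proof.
move=> u1; have [a a0 Aa] := op_le_exists A.
apply: ub_le_sup; last by exists u.
exists a => _ [v /= v1 <-]; apply: le_trans (Aa v) _.
by rewrite ler_piMr.
Qed.

Lemma opnorm_ge0 A : 0 <= opnorm A.
Proof. by rewrite (le_trans (enorm_ge0 _) (enorm_le_opnorm A (u := 0) _)) ?enorm0. Qed.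

Lemma op_le_opnorm A : op_le A (opnorm A).
Proof.
move=> u; have [/enorm_eq0 ->|u_neq0] := eqVneq (enorm u) 0.
  by rewrite mulmx0 enorm0 mulr0.
have u_gt0 : 0 < enorm u by rewrite lt0r u_neq0 enorm_ge0.
have := @enorm_le_opnorm A ((enorm u)^-1 *: u).
rewrite -scalemxAr !enormZ ger0_norm ?invr_ge0 ?enorm_ge0 // mulVf // lexx.
by move=> /(_ isT); rewrite ler_pdivrMl // mulrC.
Qed.

End Euclidean.

(** * Polynomials of a perturbed matrix and GMRES minimality *)

Variable (n : nat).
Implicit Types (A E : 'M[R]_n.+1) (q : {poly R}).

(** Induction along Horner's scheme. [C] is fixed before [E], and [e <= 1] is what makes it uniform:
    [A + E] is then bounded by [a + 1]. *)
Lemma horner_mx_perturbation A q :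
  exists2 C, 0 <= C & forall E e, 0 <= e -> e <= 1 -> op_le E e ->
    op_le (horner_mx (A + E) q - horner_mx A q) (C * e).
Proof.
elim/poly_ind: q => [|q c [C C0 IHq]].
  by exists 0 => // E e _ _ _ u; rewrite !rmorph0 subr0 mul0mx enorm0 !mul0r.
have [a a0 Aa] := op_le_exists A; have [b b0 qb] := op_le_exists (horner_mx A q).
exists (C * (a + 1) + b) => [|E e e0 e1 Ee]; first by rewrite !addr_ge0 ?mulr_ge0 ?addr_ge0.
rewrite !rmorphD !rmorphM /= !horner_mx_X !horner_mx_C.
set Q := horner_mx (A + E) q; set Q0 := horner_mx A q.
have -> : Q * (A + E) + c%:M - (Q0 * A + c%:M) = (Q - Q0) *m (A + E) + Q0 *m E.
  by rewrite opprD addrACA subrr addr0 mulmxE !mulrDr !mulrBl addrA subrK addrAC.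
have -> : (C * (a + 1) + b) * e = C * e * (a + 1) + b * e by ring.
apply: op_leD; last exact: op_leM.
apply: op_leM; [exact: mulr_ge0|exact: IHq|].
by apply: op_leD => //; exact: op_le_trans Ee.
Qed.

Lemma op_le_exp A a m : 0 <= a -> op_le A a -> op_le (A ^+ m) (a ^+ m).
Proof.
move=> a0 Aa; elim: m => [|m IHm] u; first by rewrite !expr0 mul1mx mul1r.
by rewrite !exprS -mulmxE; apply: op_leM.
Qed.

Lemma krylov_horner_mx A r k q :
  (size q <= k)%N -> horner_mx A q *m r \in krylov A r k.
Proof.
move=> qk; have -> : q = \sum_(i < k) q`_i *: 'X^i.
  by rewrite -poly_def; apply/polyP => i; rewrite coef_poly; case: ltnP => // ki;
    rewrite nth_default // (leq_trans qk).
rewrite raddf_sum mulmx_suml memv_suml // => i _ /=.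
rewrite horner_mxZ rmorphXn /= horner_mx_X -scalemxAl memvZ // memv_span //.
by apply/mapP; exists (i : nat) => //; rewrite mem_iota /= add0n.
Qed.

(** Writing [q = 1 - 'X * s], the vector [q(A) r0 = r0 - A s(A) r0] is the residual of the
    competitor [x0 + s(A) r0], whose correction lies in the Krylov space because [s] has size at
    most [k]. *)
Lemma gmres_residual_min A b x0 xk k q :
  is_gmres_iterate A b x0 k xk -> (size q <= k.+1)%N -> q.[0] = 1 ->
  enorm (residual A b xk) <= enorm (horner_mx A q *m residual A b x0).
Proof.
move=> [_ xk_min] qk q0; pose s := - drop_poly 1 q.
have qE : q = 1 - 'X * s.
  rewrite mulrN opprK mulrC -['X]expr1 -[LHS](poly_take_drop 1) -polyC1 -q0.
  congr (_ + _); apply/polyP => i; rewrite coef_take_poly coefC horner_coef0.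
  by case: i.
set r0 := residual A b x0.
have -> : horner_mx A q *m r0 = residual A b (x0 + horner_mx A s *m r0).
  rewrite qE rmorphB rmorph1 rmorphM /= horner_mx_X mulmxBl mul1mx -mulmxE.
  by rewrite [RHS]/residual (mulmxDr A x0) opprD addrA mulmxA.
apply: xk_min; rewrite addrAC subrr add0r krylov_horner_mx //.
by rewrite size_polyN size_drop_poly leq_subLR add1n.
Qed.

End Norms.

(** The columns of [V] are a basis of [D]; column [l] of [W] holds the coordinates of column [l] of
    [A] in that basis. *)
Lemma mx_factor_vspace (F : fieldType) (n k : nat) (D : {vspace 'cV[F]_n})
    (A : 'M[F]_(n, k)) :
  (forall u, A *m u \in D) ->
  exists (V : 'M_(n, \dim D)) (W : 'M_(\dim D, k)), A = V *m W.
Proof.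
move=> AD; exists (\matrix_(i, j) (vbasis D)`_j i 0).
exists (\matrix_(j, l) coord (vbasis D) j (col l A)).
apply/matrixP => i l; rewrite mxE.
have colD : col l A \in D by rewrite colE AD.
have -> : A i l = col l A i 0 by rewrite mxE.
rewrite {1}(coord_vbasis colD) summxE; apply: eq_bigr => j _.
by rewrite !mxE mulrC.
Qed.

Theorem theorem2p1 (R : realType) (N p : nat) (D : {vspace 'cV[R]_N})
    (PD K : 'M[R]_N) :
  (1 <= N)%N -> \dim D = p -> (p < N)%N ->
  is_orth_proj D PD ->
  K = PD *m K *m PD ->
  1%:M - K \in unitmx ->
  exists delta C : R, 0 < delta /\ 0 < C /\
    forall E : 'M[R]_N, opnorm E <= delta ->
    forall (b x0 : 'cV[R]_N) (x : nat -> 'cV[R]_N),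
      is_gmres (1%:M - K + E) b x0 x ->
      forall m : nat, (1 <= m)%N ->
        enorm (residual (1%:M - K + E) b (x (m * (p + 1))%N))
          <= C ^+ m * opnorm E ^+ m
             * enorm (residual (1%:M - K + E) b (x 0%N)).
Proof.
case: N D PD K => // n D PD K _ dimD _ PDproj KE IKunit.
have [|V [W KVW]] := @mx_factor_vspace _ _ _ D K.
  by move=> u; rewrite KE -!mulmxA; case: (PDproj (K *m (PD *m u))).
rewrite dimD in V W KVW.
have := IKunit; rewrite {1}KVW => /low_rank_perturbation_annihilator.
rewrite -KVW => -[q [q_size q0 qK]].
have [C C0 qC] := horner_mx_perturbation (1%:M - K) q.
(* [delta = 1] is the range of the perturbation bound; [C] may vanish, so [C + 1] secures a positive
   constant. *)
exists 1, (C + 1); do 2![split; first by rewrite ?ltr_wpDl].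
move=> E E1 b x0 x [x00 x_gmres] m m1.
have {}qC := qC E _ (opnorm_ge0 E) E1 (op_le_opnorm E).
rewrite qK subr0 in qC; rewrite x00.
have k1 : (1 <= m * (p + 1))%N by rewrite muln_gt0 m1 addn1.
(* Size is degree plus one: [q] has degree at most [p + 1], so [q ^+ m] has degree at most
   [m * (p + 1)]. *)
have qm_size : (size (q ^+ m) <= (m * (p + 1)).+1)%N.
  apply: leq_trans (size_poly_exp_leq _ _) _.
  by rewrite ltnS mulnC leq_mul // addn1 -subn1 leq_subLR.
apply: le_trans (gmres_residual_min (x_gmres _ k1) qm_size _) _.
  by rewrite horner_exp q0 expr1n.
rewrite rmorphXn -exprMn /=.
have Ce0 : 0 <= C * opnorm E by rewrite mulr_ge0 ?opnorm_ge0.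
apply: op_le_exp; first by rewrite mulr_ge0 ?opnorm_ge0 ?addr_ge0.
by apply: op_le_trans qC; rewrite ler_wpM2r ?opnorm_ge0 ?lerDl.
Qed.
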